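(* Let $\varepsilon\in\{1,-1\}$, $\gamma>0$ and $M\ge0$. Let $c_0$ be the linear functional associated to the measure $(1+\varepsilon x)^{\gamma-1}dx+M\delta(\varepsilon)$ and $c_1$ the one associated to $(1+\varepsilon x)^{\gamma}dx$, on $]-1,1[$. Let $\mu_{1,n}$ be the smallest zero of the polynomial $A_n(\lambda)$ associated with the coherent pair $(c_0,c_1)$. Then $$\lim_{n\to\infty}\mu_{1,n}=0.$$
   Context: $\delta(\varepsilon)$ is the Dirac measure at $\varepsilon$, so $c_0(p)=\int_{-1}^1p(x)(1+\varepsilon x)^{\gamma-1}dx+Mp(\varepsilon)$ and $c_1(p)=\int_{-1}^1p(x)(1+\varepsilon x)^{\gamma}dx$. Let $P_n$ (resp. $T_n$) be the monic orthogonal polynomials with respect to $c_0$ (resp. $c_1$), $k_n^{(0)}=c_0(P_n^2)$, $k_n^{(1)}=c_1(T_n^2)$. The pair is coherent: there are real numbers $\sigma_n$, $n\ge1$, with $T_n=\frac{P_{n+1}'}{n+1}-\sigma_n\frac{P_n'}{n}$. The polynomials $A_n$ are defined by $A_0(\lambda)=1$, $A_1(\lambda)=\lambda-\frac{k_1^{(0)}}{k_0^{(1)}}$ and, for $n\ge2$, $$A_n(\lambda)=\Big(\lambda-\frac{k_n^{(0)}}{n^2k_{n-1}^{(1)}}-\frac{\sigma_{n-1}^2}{(n-1)^2}\frac{k_{n-1}^{(0)}}{k_{n-1}^{(1)}}\Big)A_{n-1}(\lambda)-\frac{\sigma_{n-1}^2(k_{n-1}^{(0)})^2}{(n-1)^4k_{n-1}^{(1)}k_{n-2}^{(1)}}A_{n-2}(\lambda).$$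 Their zeros are real and positive. The number $\mu_{1,n}$ arises from the Markov-Bernstein inequality $c_1((p')^2)\le\frac{1}{\mu_{1,n}}c_0(p^2)$ for real polynomials $p$ of degree at most $n$. *)

(* Defs.v *)
From HB Require Import structures.
From mathcomp Require Import all_boot all_order all_algebra.
From mathcomp Require Import all_classical all_reals all_analysis.
Set Implicit Arguments.
Unset Strict Implicit.
Unset Printing Implicit Defensive.
Import Order.TTheory GRing.Theory Num.Theory.
Import numFieldNormedType.Exports.

Local Open Scope classical_set_scope.
Local Open Scope ring_scope.

(* For g > -1 the weight is Lebesgue integrable on ]-1, 1[ , although it is
   unbounded when g < 0, so that the integral below is finite. *)
Definition jacobi_functional (R : realType) (eps g : R) (p : {poly R}) : R :=
  Rintegral (@lebesgue_measure R) `]-1, 1[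
    (fun x => p.[x] * (1 + eps * x) `^ g).

(* The Dirac mass sits at the end point eps of ]-1, 1[ and is not seen by the
   integral over the open interval. *)
Definition c0 (R : realType) (eps gamma M : R) (p : {poly R}) : R :=
  jacobi_functional eps (gamma - 1) p + M * p.[eps].

Definition c1 (R : realType) (eps gamma : R) (p : {poly R}) : R :=
  jacobi_functional eps gamma p.

Definition monic_orthogonal (R : realType) (c : {poly R} -> R)
    (P : nat -> {poly R}) : Prop :=
  (forall n, P n \is monic /\ size (P n) = n.+1) /\
  (forall m n, m <> n -> c (P m * P n) = 0).

(* The value of sigma at 0 is irrelevant. *)
Definition coherent (R : realType) (P T : nat -> {poly R})
    (sigma : nat -> R) : Prop :=
  forall n, (1 <= n)%N ->
    T n = (n.+1%:R)^-1 *: (P n.+1)^`() - (sigma n / n%:R) *: (P n)^`().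

Definition sqnorm (R : realType) (c : {poly R} -> R) (P : nat -> {poly R})
    (n : nat) : R := c (P n ^+ 2).

(* In the last branch the index is n = l + 2, so that n - 1 = l.+1. *)
Fixpoint markov_bernstein_poly (R : realType) (k0 k1 sigma : nat -> R)
    (n : nat) : {poly R} :=
  match n with
  | 0 => 1
  | 1 => 'X - (k0 1%N / k1 0%N)%:P
  | (l.+1 as m).+1 =>
      ('X - (k0 l.+2 / (l.+2%:R ^+ 2 * k1 l.+1))%:P
          - (sigma l.+1 ^+ 2 / l.+1%:R ^+ 2 * (k0 l.+1 / k1 l.+1))%:P)
        * markov_bernstein_poly k0 k1 sigma m
      - (sigma l.+1 ^+ 2 * k0 l.+1 ^+ 2 / (l.+1%:R ^+ 4 * k1 l.+1 * k1 l))
        *: markov_bernstein_poly k0 k1 sigma l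
  end.

Definition smallest_zero (R : realType) (p : {poly R}) (x : R) : Prop :=
  root p x /\ forall y, root p y -> x <= y.

(* Main.v *)
(* Write p' in the basis (T_n), using that T_(n-1) is the derivative of
   P_n / n - sigma_(n-1) P_(n-1) / (n-1).  In these coordinates the pencil
   c0(p^2) - l c1(p'^2), restricted to c0(p) = 0 and deg p <= n, is tridiagonal and its
   principal minors are the numbers (-1)^k A_k(l) up to positive factors.  They are all
   positive when l is below the smallest zero mu_n (the smallest zeros decrease with n),
   so mu_n c1(p'^2) <= c0(p^2) whenever deg p <= n; they are also positive when l <= 0,
   so mu_n > 0.  For p = (1 + eps x)^m one has c0(p^2) = O(4^m), even with the mass M,
   while c1(p'^2) is of order m 4^m. *)

Require Import Defs.
From HB Require Import structures.
From mathcomp Require Import all_boot all_order all_algebra.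
From mathcomp Require Import all_classical all_reals all_analysis.
From mathcomp Require polyrcf.
From mathcomp Require Import measurable_realfun ring lra.
Set Implicit Arguments.
Unset Strict Implicit.
Unset Printing Implicit Defensive.
Import Order.TTheory GRing.Theory Num.Theory.
Import numFieldNormedType.Exports.

Local Open Scope classical_set_scope.
Local Open Scope ring_scope.

(** * Signs of monic polynomials away from their real roots *)

Lemma monic_gt0_of_no_root (R : rcfType) (p : {poly R}) (l : R) :
  p \is monic -> (forall y, root p y -> y < l) -> 0 < p.[l].
Proof.
move=> pm rootp; rewrite ltNge; apply/negP => pl0.
have [b pb] := monic_Cauchy_bound pm.
have [| |y /andP[ly _] /rootp] := @poly_ivt R p l (Num.max l b).
- by rewrite le_max lexx.
- by rewrite pl0 ltW// pb// le_max lexx orbT.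
- by rewrite ltNge ly.
Qed.

(** The reflection of the variable turns [(-1) ^+ n * p] into a monic polynomial whose roots all lie
    below [- l], which is the case already treated. *)
Lemma monic_sign_lt_roots (R : rcfType) (p : {poly R}) (n : nat) (l : R) :
  p \is monic -> size p = n.+1 -> (forall y, root p y -> l < y) ->
  0 < (-1) ^+ n * p.[l].
Proof.
move=> pm sp rootp; pose q := (-1) ^+ n *: (p \Po - 'X).
have sX : size (- 'X : {poly R}) = 2%N by rewrite size_polyN size_polyX.
have qm : q \is monic.
  rewrite monicE lead_coefZ lead_coef_comp ?sX//.
  by rewrite lead_coefN lead_coefX (monicP pm) mul1r sp -signr_odd -expr2 sqrr_sign.
have := @monic_gt0_of_no_root R q (- l) qm.
rewrite hornerZ horner_comp !hornerE opprK; apply=> y.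
rewrite rootE hornerZ horner_comp !hornerE mulf_eq0 signr_eq0/= => py.
by rewrite ltrNr; apply: rootp.
Qed.

(** * Monic orthogonal sequences *)

Section MonicOrthogonal.
Variables (R : realType) (c : {scalar {poly R}}) (P : nat -> {poly R}).
Hypothesis hP : monic_orthogonal c P.

Lemma monic_orthogonal_monic n : P n \is monic.
Proof. by case: hP => /(_ n)[]. Qed.

Lemma monic_orthogonal_size n : size (P n) = n.+1.
Proof. by case: hP => /(_ n)[]. Qed.

Lemma monic_orthogonal_coef n : (P n)`_n = 1.
Proof.
by have /monicP := monic_orthogonal_monic n; rewrite lead_coefE monic_orthogonal_size.
Qed.

Lemma monic_orthogonal0 : P 0 = 1.
Proof.
have /size1_polyC -> : (size (P 0) <= 1)%N by rewrite monic_orthogonal_size.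
by rewrite monic_orthogonal_coef.
Qed.

Lemma size_sub_monic_orthogonal n (q : {poly R}) : (size q <= n.+1)%N ->
  (size (q - q`_n *: P n)%R <= n)%N.
Proof.
move=> sq; apply/leq_sizeP => j; rewrite leq_eqVlt => /orP[/eqP<-|nj].
  by rewrite coefB coefZ monic_orthogonal_coef mulr1 subrr.
rewrite coefB coefZ [q`_j]nth_default; last exact: leq_trans nj.
by rewrite [(P n)`_j]nth_default ?mulr0 ?subr0// monic_orthogonal_size.
Qed.

Lemma monic_orthogonal_low n (q : {poly R}) : (size q <= n)%N -> c (q * P n) = 0.
Proof.
suff H m : (m <= n)%N -> forall r : {poly R}, (size r <= m)%N -> c (r * P n) = 0.
  exact: (H n).
elim: m => [_ r|m IHm mn r sr].
  by rewrite leqn0 size_poly_eq0 => /eqP ->; rewrite mul0r linear0.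
have mn' : m <> n by move=> mn'; rewrite mn' ltnn in mn.
have := IHm (ltnW mn) _ (size_sub_monic_orthogonal sr).
rewrite mulrBl linearB/= -scalerAl linearZ/= (hP.2 _ _ mn') mulr0 subr0.
exact.
Qed.

Lemma monic_orthogonal_top n (q : {poly R}) : (size q <= n.+1)%N ->
  c (q * P n) = q`_n * sqnorm c P n.
Proof.
move=> sq; have := monic_orthogonal_low (size_sub_monic_orthogonal sq).
rewrite mulrBl linearB/= -scalerAl linearZ/= -expr2 => /eqP.
by rewrite subr_eq0 => /eqP.
Qed.

End MonicOrthogonal.

(** * The three-term recurrence and the smallest zeros of its polynomials *)

Section MarkovBernsteinPoly.
Variables (R : realType) (k0 k1 sigma : nat -> R).
Local Notation A := (markov_bernstein_poly k0 k1 sigma).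

(** With Q the primitive of [T n.+1] supplied by coherence, [mb_alpha n.+1] and [mb_beta n] are the
    two contributions to [c0 (Q ^+ 2) / k1 n.+1]: one from [P n.+2], one from [P n.+1]. The factor
    [(-1) ^+ n] in [mb_sign] makes the value positive to the left of all zeros. *)
Definition mb_alpha n : R := k0 n.+1 / (n.+1%:R ^+ 2 * k1 n).
Definition mb_beta n : R := sigma n.+1 ^+ 2 / n.+1%:R ^+ 2 * (k0 n.+1 / k1 n.+1).
Definition mb_sign (l : R) n : R := (-1) ^+ n * (A n).[l].
Local Notation alpha := mb_alpha.
Local Notation beta := mb_beta.
Local Notation B := mb_sign.

Lemma markov_bernstein_polyS n :
  A n.+2 = ('X - (alpha n.+1)%:P - (beta n)%:P) * A n.+1
    - (sigma n.+1 ^+ 2 * k0 n.+1 ^+ 2 / (n.+1%:R ^+ 4 * k1 n.+1 * k1 n)) *: A n.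
Proof. by []. Qed.

Lemma markov_bernstein_poly_monic_size n : A n \is monic /\ size (A n) = n.+1.
Proof.
suff: (A n \is monic /\ size (A n) = n.+1) /\ (A n.+1 \is monic /\ size (A n.+1) = n.+2).
  by case.
elim: n => [|n [[m0 s0] [m1 s1]]]; split => //; last rewrite markov_bernstein_polyS.
- by rewrite monic1 size_poly1.
- by rewrite monicXsubC size_XsubC.
have mX : 'X - (alpha n.+1)%:P - (beta n)%:P \is monic.
  by rewrite -addrA -opprD -polyCD monicXsubC.
have sX : size ('X - (alpha n.+1)%:P - (beta n)%:P) = 2%N.
  by rewrite -addrA -opprD -polyCD size_XsubC.
set a := ('X - (alpha n.+1)%:P - (beta n)%:P) * A n.+1.
have ma : a \is monic by rewrite monicMl.
have sa : size a = n.+3 by rewrite size_monicM// ?sX ?s1// monic_neq0.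
set b := _ *: A n.
have sb : (size (- b) < size a)%N.
  by rewrite sa size_polyN (leq_ltn_trans (size_scale_leq _ _))// s0 ltnS leqW.
by rewrite monicE lead_coefDl// (monicP ma) size_polyDl.
Qed.

Hypotheses (k0_gt0 : forall n, 0 < k0 n) (k1_gt0 : forall n, 0 < k1 n).

Let alpha_gt0 n : 0 < alpha n.
Proof. by rewrite divr_gt0// mulr_gt0// exprn_gt0. Qed.

Let beta_ge0 n : 0 <= beta n.
Proof. by rewrite mulr_ge0 ?divr_ge0 ?sqr_ge0// ltW. Qed.

(* The coefficient of [A n] in the recurrence factors as [beta n * alpha n]: this is what
   gives positivity for [l <= 0] and the perfect square in [coherent_form_ge]. *)
Lemma markov_bernstein_signS l n :
  B l n.+2 = (alpha n.+1 + beta n - l) * B l n.+1 - beta n * alpha n * B l n.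
Proof.
have -> : beta n * alpha n =
    sigma n.+1 ^+ 2 * k0 n.+1 ^+ 2 / (n.+1%:R ^+ 4 * k1 n.+1 * k1 n).
  rewrite /mb_beta /mb_alpha; field.
  by rewrite !gt_eqF ?k1_gt0//= addrC natr1 pnatr_eq0.
by rewrite /mb_sign markov_bernstein_polyS !hornerE/= !exprS; ring.
Qed.

Lemma markov_bernstein_sign0 l : B l 0 = 1.
Proof. by rewrite /mb_sign expr0 mul1r hornerC. Qed.

Lemma markov_bernstein_sign1 l : B l 1 = alpha 0 - l.
Proof. by rewrite /mb_sign /alpha/= !hornerE expr1n mul1r expr1; ring. Qed.

Lemma markov_bernstein_sign_gt0 l n : l <= 0 -> 0 < B l n.
Proof.
move=> l0.
(* Positivity alone is not inductive. The stronger bound propagates because the recurrence reads [B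
   l m.+2 - alpha m.+1 * B l m.+1 = beta m * (B l m.+1 - alpha m * B l m) - l * B l m.+1]. *)
have H m : 0 < B l m /\ alpha m * B l m <= B l m.+1.
  elim: m => [|m [Bm HB]].
    by rewrite markov_bernstein_sign1 markov_bernstein_sign0 ltr01 mulr1; split=> //; lra.
  have B1 : 0 < B l m.+1 by apply: lt_le_trans HB; rewrite mulr_gt0.
  split=> //; rewrite markov_bernstein_signS.
  have h1 : 0 <= beta m * (B l m.+1 - alpha m * B l m).
    by rewrite mulr_ge0// subr_ge0.
  have h2 : 0 <= - l * B l m.+1 by rewrite mulr_ge0 ?oppr_ge0// ltW.
  nra.
by case: (H n).
Qed.

Lemma markov_bernstein_sign_lt_zero l n x :
  smallest_zero (A n) x -> l < x -> 0 < B l n.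
Proof.
move=> [_ xmin] lx; have [Am As] := markov_bernstein_poly_monic_size n.
by apply: monic_sign_lt_roots => // y /xmin; exact: lt_le_trans.
Qed.

Lemma markov_bernstein_zero_gt0 n x : root (A n) x -> 0 < x.
Proof.
move=> /rootP Ax; rewrite ltNge; apply/negP => /(markov_bernstein_sign_gt0 n).
by rewrite /mb_sign Ax mulr0 ltxx.
Qed.

Variable mu : nat -> R.
Hypothesis hmu : forall n, (1 <= n)%N -> smallest_zero (A n) (mu n).

(* At [mu n] the recurrence makes the values of [A n.+1] and [A n.-1] have opposite
   signs. *)
Lemma smallest_zeros_nonincreasing n : (1 <= n)%N -> mu n.+1 <= mu n.
Proof.
case: n => // n _; elim: n => [|n IHn]; rewrite leNgt; apply/negP => lt_mu.
- have := markov_bernstein_sign_lt_zero (hmu (ltn0Sn 1)) lt_mu.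
  rewrite markov_bernstein_signS {1}/mb_sign.
  have [/rootP -> _] := hmu (ltn0Sn 0).
  rewrite markov_bernstein_sign0.
  have : 0 <= beta 0 * alpha 0 by rewrite mulr_ge0// ltW.
  by rewrite mulr0 mulr0; lra.
- have := markov_bernstein_sign_lt_zero (hmu (ltn0Sn n.+2)) lt_mu.
  rewrite markov_bernstein_signS {1}/mb_sign.
  have [/rootP -> _] := hmu (ltn0Sn n.+1).
  (* The induction hypothesis puts [mu n.+2] at or to the left of the smallest zero of [A n.+1];
     coinciding zeros are not excluded, hence the weak inequality. *)
  have : 0 <= B (mu n.+2) n.+1.
    move: IHn; rewrite le_eqVlt => /orP[/eqP ->|lt_mu'].
      by have [/rootP r _] := hmu (ltn0Sn n); rewrite /mb_sign r mulr0.
    by rewrite ltW// (markov_bernstein_sign_lt_zero (hmu (ltn0Sn n))).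
  have : 0 <= beta n.+1 * alpha n.+1 by rewrite mulr_ge0// ltW.
  by rewrite mulr0 mulr0; nra.
Qed.

Lemma smallest_zeros_antitone m n : (1 <= m)%N -> (m <= n)%N -> mu n <= mu m.
Proof.
move=> m1; elim: n => [|n IHn].
  by rewrite leqn0 => /eqP m0; rewrite m0 in m1.
rewrite leq_eqVlt => /orP[/eqP -> //|mn].
by apply: le_trans (IHn mn); apply: smallest_zeros_nonincreasing; exact: leq_trans m1 mn.
Qed.

End MarkovBernsteinPoly.

(** * The Markov-Bernstein inequality for an abstract coherent pair *)

Definition positive_definite (R : realType) (c : {poly R} -> R) :=
  forall p, p != 0 -> 0 < c (p ^+ 2).

Lemma positive_definite_ge0 (R : realType) (c : {scalar {poly R}}) p :
  positive_definite c -> 0 <= c (p ^+ 2).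
Proof.
by move=> cpd; have [->|/cpd/ltW//] := eqVneq p 0; rewrite expr0n linear0.
Qed.

Section CoherentPair.
Variables (R : realType) (c0 c1 : {scalar {poly R}}).
Variables (P T : nat -> {poly R}) (sigma : nat -> R).
Hypotheses (c0_pd : positive_definite c0) (c1_pd : positive_definite c1).
Hypotheses (hP : monic_orthogonal c0 P) (hT : monic_orthogonal c1 T).
Hypothesis hsigma : coherent P T sigma.

Local Notation k0 := (sqnorm c0 P).
Local Notation k1 := (sqnorm c1 T).
Local Notation A := (markov_bernstein_poly k0 k1 sigma).
Local Notation B := (mb_sign k0 k1 sigma).

Lemma sqnorm0_gt0 n : 0 < k0 n.
Proof. by apply: c0_pd; rewrite monic_neq0// (monic_orthogonal_monic hP). Qed.

Lemma sqnorm1_gt0 n : 0 < k1 n.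
Proof. by apply: c1_pd; rewrite monic_neq0// (monic_orthogonal_monic hT). Qed.

Lemma scalar_sqrD (c : {scalar {poly R}}) (p q : {poly R}) (x : R) :
  c ((p + x *: q) ^+ 2) = c (p ^+ 2) + 2 * x * c (p * q) + x ^+ 2 * c (q ^+ 2).
Proof.
have -> : (p + x *: q) ^+ 2 = p ^+ 2 + (2 * x) *: (p * q) + x ^+ 2 *: q ^+ 2.
  by rewrite sqrrD exprZn -scalerAr -scaler_nat scalerA.
by rewrite !linearD !(scalarZ c).
Qed.

(** Coherence makes [Q n] a primitive of [T n.+1], and [c0] kills it because only [P] of positive
    index occur. With [P 1], a primitive of [T 0], these polynomials form the basis of the kernel of
    [c0] in which the derivative form is diagonal. *)
Let Q n : {poly R} := n.+2%:R^-1 *: P n.+2 - (sigma n.+1 / n.+1%:R) *: P n.+1.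

Let coefQ n : (Q n)`_n.+2 = n.+2%:R^-1.
Proof.
rewrite coefB !coefZ (monic_orthogonal_coef hP) mulr1 nth_default ?mulr0 ?subr0//.
by rewrite (monic_orthogonal_size hP).
Qed.

Let sizeQ n : (size (Q n) <= n.+3)%N.
Proof.
rewrite (leq_trans (size_polyD _ _))// geq_max size_polyN.
by rewrite !(leq_trans (size_scale_leq _ _))// (monic_orthogonal_size hP).
Qed.

Let derivQ n : (Q n)^`() = T n.+1.
Proof. by rewrite derivB !derivZ hsigma. Qed.

Let c0Q n : c0 (Q n) = 0.
Proof.
have h m : c0 (P m.+1) = 0.
  by rewrite -[P _]mul1r (monic_orthogonal_low hP)// size_poly1.
by rewrite linearB !(scalarZ c0) !h !mulr0 subrr.
Qed.

(** The term in [P n.+2] is orthogonal to [q], and [P n.+1] sees only the top coefficient of [q].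
    Hence [Q n] interacts only with its immediate predecessor, which makes the form tridiagonal. *)
Let c0qQ n (q : {poly R}) : (size q <= n.+2)%N ->
  c0 (q * Q n) = - (sigma n.+1 / n.+1%:R * (q`_n.+1 * k0 n.+1)).
Proof.
move=> sq; have sc a m : q * (a *: P m) = a *: (q * P m) by rewrite -scalerAr.
rewrite mulrBr !sc linearB !(scalarZ c0).
rewrite (monic_orthogonal_low hP)// (monic_orthogonal_top hP)//.
by rewrite mulr0 sub0r.
Qed.

Let c0QQ n : c0 (Q n ^+ 2) =
  k0 n.+2 / n.+2%:R ^+ 2 + sigma n.+1 ^+ 2 / n.+1%:R ^+ 2 * k0 n.+1.
Proof.
rewrite /Q -scaleNr scalar_sqrD [(_ *: P _) ^+ 2]exprZn -[_ *: P _ * _]scalerAl.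
rewrite !(scalarZ c0).
have -> : c0 (P n.+2 * P n.+1) = 0.
  by apply: hP.2; apply/eqP; rewrite gtn_eqF.
rewrite !mulr0 addr0 sqrrN exprVn -/(sqnorm c0 P n.+2) -/(sqnorm c0 P n.+1).
by rewrite expr_div_n mulrC.
Qed.

(* Peeling off the component of [p^`()] along [T n] is one step of the Cholesky
   factorisation of [p |-> c0 (p ^+ 2) - l * c1 (p^`() ^+ 2)]. *)
Lemma coherent_form_ge l n (p : {poly R}) :
  (forall k, (k <= n.+1)%N -> 0 < B l k) -> (size p <= n.+2)%N -> c0 p = 0 ->
  B l n.+1 / B l n * k1 n * (n.+1%:R * p`_n.+1) ^+ 2
    <= c0 (p ^+ 2) - l * c1 (p^`() ^+ 2).
Proof.
elim: n p => [|n IHn] p Bgt0 sp c0p.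
  have sr := size_sub_monic_orthogonal hP sp.
  (* The remainder is a constant annihilated by [c0], and [c0 1 > 0]. *)
  have er : p - p`_1 *: P 1 = 0.
    set r := p - _ in sr *; have rC := size1_polyC sr.
    have : c0 r = 0.
      rewrite /r linearB (scalarZ c0) c0p -[P 1]mul1r.
      by rewrite (monic_orthogonal_low hP) ?size_poly1// mulr0 subr0.
    rewrite rC -alg_polyC (scalarZ c0) => /eqP.
    have := c0_pd (oner_neq0 _); rewrite expr1n => c01.
    by rewrite mulf_eq0 (gt_eqF c01) orbF => /eqP ->; rewrite scale0r.
  have ep : p = p`_1 *: P 1 by apply/eqP; rewrite -subr_eq0 er.
  have ed : p^`() = p`_1 *: T 0.
    rewrite ep derivZ (monic_orthogonal0 hT) coefZ (monic_orthogonal_coef hP) mulr1.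
    congr (_ *: _); apply/polyP => i; rewrite coef_deriv coef1.
    case: i => [|i]; first by rewrite (monic_orthogonal_coef hP).
    by rewrite nth_default ?mul0rn// (monic_orthogonal_size hP).
  have e0 : c0 (p ^+ 2) = p`_1 ^+ 2 * k0 1 by rewrite {1}ep exprZn (scalarZ c0).
  have e1 : c1 (p^`() ^+ 2) = p`_1 ^+ 2 * k1 0 by rewrite ed exprZn (scalarZ c1).
  rewrite e0 e1 markov_bernstein_sign1 markov_bernstein_sign0 /mb_alpha.
  rewrite le_eqVlt; apply/orP; left.
  by apply/eqP; field; rewrite gt_eqF// sqnorm1_gt0.
(* [x] is the coefficient of degree [n.+1] of the derivative of [p], hence its component along the
   monic [T n.+1]. Subtracting [x *: Q n] lowers the degree and stays in the kernel of [c0]. *)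
pose x := n.+2%:R * p`_n.+2; pose q := p - x *: Q n.
have sq : (size q <= n.+2)%N.
  apply/leq_sizeP => j; rewrite leq_eqVlt => /orP[/eqP<-|nj].
    by rewrite coefB coefZ coefQ /x mulrAC divff ?pnatr_eq0// mul1r subrr.
  by rewrite coefB coefZ ![_`_j]nth_default ?mulr0 ?subrr// (leq_trans _ nj).
have pq : p = q + x *: Q n by rewrite subrK.
have c0q : c0 q = 0 by rewrite linearB (scalarZ c0) c0p c0Q mulr0 subr0.
have Bgt0' k : (k <= n.+1)%N -> 0 < B l k by move=> kn; apply: Bgt0; exact: leqW.
have IH := IHn q Bgt0' sq c0q.
have c0pp : c0 (p ^+ 2) = c0 (q ^+ 2)
    - 2 * x * (sigma n.+1 / n.+1%:R * (q`_n.+1 * k0 n.+1))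
    + x ^+ 2 * (k0 n.+2 / n.+2%:R ^+ 2 + sigma n.+1 ^+ 2 / n.+1%:R ^+ 2 * k0 n.+1).
  by rewrite [in LHS]pq scalar_sqrD c0qQ// c0QQ mulrN.
have c1pp : c1 (p^`() ^+ 2) = c1 (q^`() ^+ 2) + x ^+ 2 * k1 n.+1.
  rewrite [in LHS]pq derivD derivZ derivQ scalar_sqrD.
  rewrite (monic_orthogonal_low hT) ?mulr0 ?addr0//.
  by rewrite (leq_trans (size_poly _ _))// -subn1 leq_subLR add1n.
rewrite -/x c0pp c1pp markov_bernstein_signS; [|exact: sqnorm1_gt0].
set N := n.+1%:R in IH *; set N' := n.+2%:R.
have N0 : N != 0 by rewrite pnatr_eq0.
have N'0 : N' != 0 by rewrite pnatr_eq0.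
have B1 := Bgt0' n.+1 (leqnn _); have B0 := Bgt0' n (leqnSn _).
have K0 := sqnorm1_gt0 n; have K1 := sqnorm1_gt0 n.+1.
rewrite -subr_ge0.
(* Completing the square: the gap to be shown nonnegative equals the slack in the induction
   hypothesis plus the square below divided by [r]. The coefficients of [x ^+ 2] agree because the
   recurrence subtracts exactly [beta n * alpha n * B l n]. *)
pose r := B l n.+1 / B l n * k1 n.
have r0 : 0 < r by rewrite mulr_gt0// divr_gt0.
have := divr_ge0 (sqr_ge0 (r * (N * q`_n.+1) - x * (sigma n.+1 * k0 n.+1 / N ^+ 2))) (ltW r0).
have : 0 <= c0 (q ^+ 2) - l * c1 (q^`() ^+ 2) - r * (N * q`_n.+1) ^+ 2 by rewrite subr_ge0.
move=> h1 h2; apply: le_trans (addr_ge0 h2 h1) _; rewrite le_eqVlt; apply/orP; left.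
apply/eqP; rewrite /r /mb_alpha /mb_beta -/N -/N'; field.
by rewrite !gt_eqF// ltr_pwDl// ?addr_ge0//.
Qed.

Variable mu : nat -> R.
Hypothesis hmu : forall n, (1 <= n)%N -> smallest_zero (A n) (mu n).

Lemma mu_markov_bernstein n (p : {poly R}) : (1 <= n)%N -> (size p <= n.+1)%N ->
  mu n * c1 (p^`() ^+ 2) <= c0 (p ^+ 2).
Proof.
case: n => // n _ sp.
(* Subtracting the mean [b] projects orthogonally onto the kernel of [c0]: the derivative is
   unchanged and [c0 (p ^+ 2)] can only decrease. *)
pose b := c0 p / c0 1; pose q := p - b%:P.
have c01 : 0 < c0 1 by rewrite -(expr1n _ 2); apply: c0_pd; exact: oner_neq0.
have cb r : c0 (r * b%:P) = b * c0 r by rewrite mulrC mul_polyC (scalarZ c0).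
have c0q : c0 q = 0.
  by rewrite linearB -[b%:P]mul1r cb mulfVK ?subrr// gt_eqF.
have sq : (size q <= n.+2)%N.
  rewrite (leq_trans (size_polyD _ _))// geq_max sp size_polyN.
  by rewrite (leq_trans (size_polyC_leq1 _)).
have dq : q^`() = p^`() by rewrite derivB derivC subr0.
have le_qp : c0 (q ^+ 2) <= c0 (p ^+ 2).
  have -> : p = q + b *: 1 by rewrite alg_polyC subrK.
  rewrite scalar_sqrD mulr1 c0q mulr0 addr0 lerDl expr1n.
  by rewrite mulr_ge0 ?sqr_ge0// ltW.
apply: le_trans le_qp; rewrite -dq.
(* Strictness keeps every [B l k] positive, since [B l n.+1] vanishes at [mu n.+1] itself. *)
have form l : l < mu n.+1 -> l * c1 (q^`() ^+ 2) <= c0 (q ^+ 2).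
  move=> lmu; have Bgt0 k : (k <= n.+1)%N -> 0 < B l k.
    case: k => [_|k kn]; first by rewrite markov_bernstein_sign0.
    apply: (markov_bernstein_sign_lt_zero (hmu (ltn0Sn k))).
    apply: lt_le_trans lmu _.
    exact: smallest_zeros_antitone sqnorm0_gt0 sqnorm1_gt0 _ hmu _ _ _ kn.
  rewrite -subr_ge0; apply: le_trans (coherent_form_ge Bgt0 sq c0q).
  apply: mulr_ge0 (sqr_ge0 _); apply: mulr_ge0; last exact/ltW/sqnorm1_gt0.
  by apply: divr_ge0; apply/ltW/Bgt0.
have := positive_definite_ge0 (q^`()) c1_pd.
rewrite le_eqVlt => /orP[/eqP <-|c1q]; first by rewrite mulr0 positive_definite_ge0.
(* Passage to [mu n.+1]: if the quotient of the two forms were smaller, the midpoint between them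
   would contradict [form]. *)
rewrite leNgt -ltr_pdivrMr//; apply/negP => lt_mu.
have [lt_mid mid_lt] := midf_lt lt_mu.
by have := form _ mid_lt; rewrite leNgt -ltr_pdivrMr// lt_mid.
Qed.

(** A single test polynomial bounds [mu n] for every [n] past its degree, and [mu n] is positive; so
    it is enough that the quotient of the two forms takes arbitrarily small values. *)
Lemma smallest_zeros_cvg0 :
  (forall e, 0 < e -> exists p : {poly R},
     0 < c1 (p^`() ^+ 2) /\ c0 (p ^+ 2) <= e * c1 (p^`() ^+ 2)) ->
  mu n @[n --> \oo] --> (0 : R).
Proof.
move=> small; apply/cvgrPdist_le => e e0; have [p [p0 pe]] := small e e0.
exists (size p).+1 => // n /= pn.
have n1 : (1 <= n)%N by apply: leq_trans pn.
have mun0 : 0 < mu n.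
  have [r _] := hmu n1.
  exact: markov_bernstein_zero_gt0 sqnorm0_gt0 sqnorm1_gt0 _ _ r.
rewrite sub0r normrN gtr0_norm// -(ler_pM2r p0) (le_trans _ pe)//.
by apply: mu_markov_bernstein => //; rewrite leqW// ltnW.
Qed.

End CoherentPair.

(** * Integrals against the weight, and positivity *)

Section JacobiWeight.
Variables (R : realType) (eps : R).
Hypothesis heps : eps = 1 \/ eps = -1.
Local Notation mu := (@lebesgue_measure R).
Local Notation I := (`]-1, 1[%classic : set R).

Lemma affine_gt0 (x : R) : -1 < x < 1 -> 0 < 1 + eps * x.
Proof. by case: heps => -> /andP[]; lra. Qed.

Lemma is_derive_weight (s x : R) : -1 < x < 1 ->
  is_derive x 1 (fun y : R => (1 + eps * y) `^ s) (eps * (s * (1 + eps * x) `^ (s - 1))).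
Proof.
move=> /affine_gt0 u0.
have du : is_derive x (1 : R) (fun y : R => 1 + eps * y) eps.
  by apply: is_derive_eq; rewrite add0r mul1r -[_ *: _]/(_ * _) mulr1.
have dp := is_derive1_powR s u0.
have := @is_derive1_comp R (fun z : R => z `^ s) (fun y : R => 1 + eps * y) _ _ _ dp du.
by rewrite mulrC.
Qed.

Lemma continuous_weight (s x : R) : -1 < x < 1 ->
  {for x, continuous (fun y : R => (1 + eps * y) `^ s)}.
Proof.
move=> /(is_derive_weight s)[d _].
exact/differentiable_continuous/derivable1_diffP.
Qed.

(** The segment avoids the end point [- eps], where the weight may be singular, so the fundamental
    theorem of calculus applies. Its symmetry makes the value independent of the sign of [eps]. *)
Lemma integral_weight_segment (s a : R) : 0 < s -> 0 < a < 1 ->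
  (\int[mu]_(x in `[(- a)%R, a]) ((1 + eps * x) `^ (s - 1))%:E)%E =
   (((1 + a) `^ s - (1 - a) `^ s) / s)%:E.
Proof.
move=> s0 /andP[a0 a1].
have itv (x : R) : - a <= x <= a -> -1 < x < 1 by move=> /andP[]; lra.
pose F (y : R) : R := eps / s * (1 + eps * y) `^ s.
have dF (x : R) : -1 < x < 1 -> is_derive x (1 : R) F ((1 + eps * x) `^ (s - 1)).
  move=> /(is_derive_weight s) d.
  have -> : (1 + eps * x) `^ (s - 1) =
      eps / s * (eps * (s * (1 + eps * x) `^ (s - 1))).
    by case: heps => ->; field; rewrite gt_eqF.
  exact: (is_deriveZ (eps / s) d).
have cF (x : R) : -1 < x < 1 -> {for x, continuous F}.
  by move=> /dF[d _]; exact/differentiable_continuous/derivable1_diffP.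
rewrite (@continuous_FTC2 _ _ F).
- rewrite -EFinB /F; congr EFin.
  by case: heps => ->; rewrite ?mulN1r ?opprK ?mul1r ?mulrN1; field; rewrite gt_eqF.
- by rewrite gtrN.
- apply: continuous_in_subspaceT => x; rewrite inE/= in_itv/= => /itv.
  exact: continuous_weight.
- split.
  + by move=> x; rewrite in_itv/= => /andP[xa ax]; case: (dF x) => //; apply/itv; rewrite !ltW.
  + by apply: cvg_at_right_filter; apply: cF; lra.
  + by apply: cvg_at_left_filter; apply: cF; lra.
- move=> x; rewrite in_itv/= => /andP[xa ax]; rewrite derive1E.
  by case: (dF x) => //; apply/itv; rewrite !ltW.
Qed.

Lemma measurable_weight (g : R) : measurable_fun setT (fun x : R => (1 + eps * x) `^ g).
Proof.
apply: (measurableT_comp (measurable_powR g)).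
by apply: measurable_funD => //; exact: measurable_funM.
Qed.

Lemma integral_weight (s : R) : 0 < s ->
  (\int[mu]_(x in I) ((1 + eps * x) `^ (s - 1))%:E)%E = (2 `^ s / s)%:E.
Proof.
move=> s0.
(* The open interval is exhausted by the segments [K n] and monotone convergence is applied. The
   shift by two keeps [1 - v n] strictly between 0 and 1 already at [n = 0]. *)
pose v n : R := n.+2%:R^-1.
have v01 n : 0 < v n < 1 by rewrite invr_gt0 ltr0n/= invf_lt1 ?ltr1n ?ltr0n.
pose K n : set R := `[- (1 - v n), 1 - v n]%classic.
have v0 : v n @[n --> \oo] --> (0 : R).
  by have := @cvg_harmonic R; rewrite -cvg_shiftS.
have KI : \bigcup_n K n = I.
  rewrite eqEsubset; split=> x.
    move=> [n _]; rewrite /K/= !in_itv/= => /andP[]; have /andP[] := v01 n.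
    by move=> ? ? ? ?; apply/andP; split; lra.
  rewrite /= in_itv/= => /andP[x1 x2].
  have d0 : 0 < Num.min (1 - x) (1 + x) by rewrite lt_min; apply/andP; split; lra.
  have /cvgrPdist_lt/(_ _ d0)[n _ /(_ n (leqnn n))] := v0.
  rewrite sub0r normrN gtr0_norm; last by case/andP: (v01 n).
  rewrite lt_min => /andP[h1 h2]; exists n => //.
  by rewrite /K/= in_itv/=; apply/andP; split; lra.
have ndK : nondecreasing_seq K.
  move=> m n mn; apply/subsetPset => x; rewrite /K/= !in_itv/= => /andP[h1 h2].
  have : v n <= v m by rewrite /v lef_pV2 ?posrE ?ltr0n// ler_nat.
  by move=> ?; apply/andP; split; lra.
have := @ge0_nondecreasing_set_cvg_integral _ (measurableTypeR R) R K
  (fun x => ((1 + eps * x) `^ (s - 1))%:E) mu ndK.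
rewrite KI => cvgI; apply: (cvg_unique _ (cvgI _ _ _)) => //.
- by move=> n; exact: measurable_itv.
- by move=> n; apply/measurable_EFinP; apply: measurable_funTS; exact: measurable_weight.
- by move=> n x _; rewrite lee_fin powR_ge0.
have -> : (fun n => (\int[mu]_(x in K n) ((1 + eps * x) `^ (s - 1))%:E)%E) =
    (fun n => (((2 - v n) `^ s - (v n) `^ s) / s)%:E).
  apply/funext => n; rewrite integral_weight_segment//; last by have := v01 n; lra.
  by congr (((_ `^ _ - _ `^ _) / _)%:E); ring.
apply: cvg_EFin; first exact: nearW.
rewrite -[2 `^ s]subr0; apply: cvgM; last exact: cvg_cst; apply: cvgB.
  have d2 : derivable (fun x : R => x `^ s) 2 1.
    by case: (is_derive1_powR s (ltr0Sn R 1)).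
  move/derivable1_diffP/differentiable_continuous: d2 => c2.
  apply: (continuous_cvg _ c2); rewrite -[X in _ --> X]subr0.
  by apply: cvgB => //; exact: cvg_cst.
by apply: (cvg_at_rightP _ 0 0).1 (powR_cvg0 s0) _ _; split=> // n; case/andP: (v01 n).
Qed.

Lemma integrable_weight (g : R) : -1 < g ->
  mu.-integrable I (EFin \o (fun x : R => (1 + eps * x) `^ g)).
Proof.
move=> g1; apply/integrableP; split.
  by apply/measurable_EFinP; apply: measurable_funTS; exact: measurable_weight.
have := @integral_weight (g + 1); rewrite addrK => ig.
under eq_integral do rewrite /= ger0_norm ?powR_ge0//.
by rewrite ig ?ltry//; lra.
Qed.

Lemma integrable_poly_weight (g : R) (p : {poly R}) : -1 < g ->
  mu.-integrable I (EFin \o (fun x : R => p.[x] * (1 + eps * x) `^ g)).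
Proof.
move=> g1; apply: (integrableMr _ _ _ (integrable_weight g1)) => //.
  apply: measurable_funTS; apply: continuous_measurable_fun.
  exact: continuous_horner.
have [N [_ HN]] : [bounded p.[x] | x in (`[-1, 1]%classic : set R)].
  have [N [Nr HN]] := compact_bounded (continuous_compact
    (continuous_subspaceT (@continuous_horner R p)) (@segment_compact R (-1) 1)).
  exists N; split => // M NM x Ix.
  by apply: HN NM _ _; exists x.
exists N; split; first exact: num_real.
by move=> M NM x Ix; apply: (HN _ NM); exact: subset_itv_oo_cc.
Qed.

Lemma jacobi_functional_linear (g : R) : -1 < g -> scalar (jacobi_functional eps g).
Proof.
move=> g1 a p q; rewrite /jacobi_functional.
have mI : measurable I by exact: measurable_itv.
rewrite -RintegralZl//; last exact: integrable_poly_weight.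
rewrite -RintegralD//.
- by apply: eq_Rintegral => x _; rewrite hornerD hornerZ mulrDl mulrA.
- have := integrable_poly_weight (a *: p) g1.
  by congr (_.-integrable _ (_ \o _)); apply/funext => x; rewrite hornerZ mulrA.
- exact: integrable_poly_weight.
Qed.

(** A zero integral would force the nonnegative integrand to vanish almost everywhere. As the weight
    is positive on the open interval, the latter would be covered by a null set and the finitely
    many roots of [p], against its length 2. *)
Lemma jacobi_functional_gt0 (g : R) (p : {poly R}) : -1 < g -> p != 0 ->
  0 < jacobi_functional eps g (p ^+ 2).
Proof.
move=> g1 p0; have ge0 x : 0 <= (p ^+ 2).[x] * (1 + eps * x) `^ g.
  by rewrite mulr_ge0 ?powR_ge0// horner_exp sqr_ge0.
rewrite lt0r [X in _ && X]Rintegral_ge0 ?andbT; last by move=> x _; exact: ge0.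
apply/negP => /eqP int0.
have intf := integrable_poly_weight (p ^+ 2) g1.
have : (\int[mu]_(x in I) `|((p ^+ 2).[x] * (1 + eps * x) `^ g)%:E|)%E = 0%E.
  under eq_integral do rewrite /= ger0_norm//.
  rewrite -[LHS]fineK; last exact: integral_fune_fin_num.
  by rewrite -[fine _]/(jacobi_functional eps g (p ^+ 2)) int0.
have mI : measurable I by exact: measurable_itv.
move/(ae_eq_integral_abs mu mI (measurable_int _ intf)) => [N [mN N0 sub]].
have subI : I `<=` N `|` [set` polyrcf.rootsR p].
  move=> x Ix; apply: contrapT => /not_orP[Nx rx]; apply: Nx; apply: sub => /=.
  move=> /(_ Ix) [/eqP]; rewrite horner_exp mulf_eq0 expf_eq0/= => /orP[px|].
    by apply: rx => /=; rewrite -(polyrcf.roots_on_rootsR p0) in_itv/= rootE.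
  have := affine_gt0; rewrite /= in_itv/= in Ix => /(_ x Ix) u0.
  by rewrite powR_eq0 (gt_eqF u0).
have cr : countable [set` polyrcf.rootsR p].
  by apply: finite_set_countable; exact: finite_seq.
have mr : measurable ([set` polyrcf.rootsR p] : set (measurableTypeR R)).
  by apply: countable_measurable cr => t; exact: measurable_set1.
have roots0 := countable_lebesgue_measure0 cr.
have : mu.-negligible I.
  apply: (@negligibleS _ (measurableTypeR R) R mu _ _ subI).
  apply: (@negligibleU _ (measurableTypeR R) R mu).
    by exists N; split.
  by exists [set` polyrcf.rootsR p]; split.
move=> /(@measure_negligible _ (measurableTypeR R) R mu _ mI) => I0.
have := @lebesgue_measure_itv R `]-1, 1[; rewrite [LHS]I0/= lte_fin (_ : -1 < 1)/=; last lra.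
by rewrite -EFinB => -[]; lra.
Qed.

(** The power is absorbed into the weight, which shifts the exponent [s] to [s + k]. *)
Lemma jacobi_functional_affineX (s : R) (k : nat) : 0 < s ->
  jacobi_functional eps (s - 1) ((1 + eps *: 'X) ^+ k) = 2 `^ s * 2 ^+ k / (s + k%:R).
Proof.
move=> s0; rewrite /jacobi_functional.
transitivity (Rintegral mu I (fun x => (1 + eps * x) `^ (s + k%:R - 1))).
  apply: eq_Rintegral => x; rewrite inE/= in_itv/= => /affine_gt0 u0.
  rewrite !hornerE -powR_mulrn ?ltW// -powRD; last by rewrite (gt_eqF u0) implybT.
  by congr (_ `^ _); ring.
rewrite /Rintegral integral_weight ?ltr_wpDr//=.
by rewrite powRD ?powR_mulrn// pnatr_eq0 implybT.
Qed.

End JacobiWeight.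

(** * The functionals of the theorem and the test polynomials *)

Section JacobiFunctionals.
Variables (R : realType) (eps gamma M : R).
Hypotheses (heps : eps = 1 \/ eps = -1) (hgamma : 0 < gamma) (hM : 0 <= M).

Let gamma1 : -1 < gamma - 1. Proof. by rewrite ltrBrDl subrr. Qed.
Let gamma0 : -1 < gamma. Proof. by rewrite (lt_trans _ hgamma)// ltrN10. Qed.

Lemma c0_linear : scalar (c0 eps gamma M).
Proof.
move=> a p q; rewrite /c0 (jacobi_functional_linear heps gamma1) !hornerE /=.
ring.
Qed.

Lemma c1_linear : scalar (c1 eps gamma).
Proof. exact: (jacobi_functional_linear heps gamma0). Qed.

Definition c0_scalar : {scalar {poly R}} :=
  HB.pack (c0 eps gamma M) (GRing.isLinear.Build R {poly R} R _ _ c0_linear).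

Definition c1_scalar : {scalar {poly R}} :=
  HB.pack (c1 eps gamma) (GRing.isLinear.Build R {poly R} R _ _ c1_linear).

Lemma c0_positive_definite : positive_definite (c0 eps gamma M).
Proof.
move=> p p0; rewrite /c0 ltr_wpDr// ?jacobi_functional_gt0//.
by rewrite mulr_ge0// horner_exp sqr_ge0.
Qed.

Lemma c1_positive_definite : positive_definite (c1 eps gamma).
Proof. by move=> p p0; exact: jacobi_functional_gt0. Qed.

Let U : {poly R} := 1 + eps *: 'X.

Lemma c0_affineX k : c0 eps gamma M (U ^+ k) = 2 ^+ k * (2 `^ gamma / (gamma + k%:R) + M).
Proof.
rewrite /c0 jacobi_functional_affineX// !hornerE.
(* The mass sits where [U] takes the value 2, so it contributes [M * 2 ^+ k]. *)
have -> : eps * eps = 1 by case: heps => ->; ring.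
have -> : 1 + 1 = 2 :> R by [].
by field; rewrite gt_eqF// ltr_wpDr.
Qed.

Lemma c1_affineX k : c1 eps gamma (U ^+ k) = 2 ^+ k * (2 `^ gamma * 2 / (gamma + 1 + k%:R)).
Proof.
rewrite /c1 -{1}[gamma](addrK 1) jacobi_functional_affineX ?addr_gt0//.
rewrite powRD; last by rewrite pnatr_eq0 implybT.
by rewrite powRr1//; field; rewrite gt_eqF// ltr_wpDr// addr_gt0.
Qed.

Lemma small_rayleigh_quotient e : 0 < e -> exists p : {poly R},
  0 < c1 eps gamma (p^`() ^+ 2) /\
  c0 eps gamma M (p ^+ 2) <= e * c1 eps gamma (p^`() ^+ 2).
Proof.
move=> e0; pose G : R := 2 `^ gamma.
have G0 : 0 < G by rewrite powR_gt0.
(* With [m = k.+1], the estimates below bound the quotient for [U ^+ m] by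
   [2 * (G + M) * (gamma + 2) / (G * m)]; this is at most [e] once [m] reaches [C]. *)
pose C := 2 * (G + M) * (gamma + 2) / (e * G).
have eG0 : 0 < e * G by rewrite mulr_gt0.
have C0 : 0 <= C by rewrite divr_ge0 ?mulr_ge0 ?addr_ge0// ltW.
pose k := Num.bound C; have kC : C < k%:R by apply: archi_boundP.
exists (U ^+ k.+1).
have -> : (U ^+ k.+1)^`() ^+ 2 = (k.+1%:R ^+ 2) *: U ^+ (2 * k).
  rewrite deriv_exp derivD derivC add0r derivZ derivX alg_polyC /=.
  have ee : (eps%:P : {poly R}) ^+ 2 = 1.
    by rewrite -polyC_exp; case: heps => ->; rewrite ?sqrrN expr1n.
  by rewrite -scaler_nat exprZn exprMn ee mul1r -exprM mulnC.
have c1Z a p : c1 eps gamma (a *: p) = a * c1 eps gamma p.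
  exact: (scalarZ c1_scalar).
have -> : (U ^+ k.+1) ^+ 2 = U ^+ (2 + 2 * k) by rewrite -exprM mulnC mulnS.
rewrite c1Z c1_affineX c0_affineX exprD -/G.
set m := k.+1%:R; set d := gamma + 1 + (2 * k)%:R; set w : R := 2 ^+ (2 * k).
have w0 : 0 < w by rewrite exprn_gt0.
have m0 : 0 < m by rewrite ltr0n.
have d0 : 0 < d by rewrite ltr_wpDr// addr_gt0.
have dm : d <= (gamma + 2) * m.
  rewrite /d /m natrM -natr1; have : 0 <= gamma * k%:R by rewrite mulr_ge0 ?ltW.
  nra.
have GM : 2 * (G + M) * (gamma + 2) <= e * G * m.
  by rewrite [leRHS]mulrC -ler_pdivrMr// (le_trans (ltW kC))// ler_nat.
split.
  by apply: mulr_gt0 (exprn_gt0 _ m0) (mulr_gt0 w0 _); rewrite divr_gt0// mulr_gt0.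
have -> : e * (m ^+ 2 * (w * (G * 2 / d))) = w * (e * m ^+ 2 * (G * 2) / d).
  by rewrite !mulrA; field; rewrite gt_eqF.
rewrite [2 ^+ 2 * w]mulrC -[leLHS]mulrA ler_pM2l// ler_pdivlMr//.
(* This crude bound suffices: the factor [m ^+ 2 / d], at least [m / (gamma + 2)], already drives
   the quotient to 0. *)
have hG : G / (gamma + (2 + 2 * k)%:R) <= G.
  rewrite ler_pdivrMr ?ltr_wpDr//; apply: ler_peMr; first exact: ltW.
  by apply: ler_wpDl (ltW hgamma) _; rewrite ler1n.
apply: (@le_trans _ _ (2 ^+ 2 * (G + M) * d)).
  by rewrite ler_pM2r// ler_pM2l ?exprn_gt0// lerD2r.
apply: (@le_trans _ _ (2 * m * (2 * (G + M) * (gamma + 2)))).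
  have -> : 2 * m * (2 * (G + M) * (gamma + 2)) = 2 ^+ 2 * (G + M) * ((gamma + 2) * m) by ring.
  by rewrite ler_pM2l// mulr_gt0 ?exprn_gt0// ltr_pwDl.
apply: (@le_trans _ _ (2 * m * (e * G * m))); first by rewrite ler_pM2l// mulr_gt0.
by rewrite le_eqVlt; apply/orP; left; apply/eqP; ring.
Qed.

End JacobiFunctionals.

Theorem mainTheorem17 (R : realType) (eps gamma M : R)
  (heps : eps = 1 \/ eps = -1) (hgamma : 0 < gamma) (hM : 0 <= M)
  (P T : nat -> {poly R}) (sigma mu : nat -> R)
  (hP : monic_orthogonal (c0 eps gamma M) P)
  (hT : monic_orthogonal (c1 eps gamma) T)
  (hsigma : coherent P T sigma)
  (hmu : forall n, (1 <= n)%N ->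
     smallest_zero
       (markov_bernstein_poly (sqnorm (c0 eps gamma M) P)
          (sqnorm (c1 eps gamma) T) sigma n) (mu n)) :
  mu n @[n --> \oo] --> (0 : R).
Proof.
apply: (@smallest_zeros_cvg0 R (c0_scalar M heps hgamma) (c1_scalar heps hgamma)
  P T sigma) => //.
- exact: c0_positive_definite.
- exact: c1_positive_definite.
- exact: small_rayleigh_quotient.
Qed.
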